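(* Let $r\geq2$. Then for all $n\geq1$, $$\det(-1;F_0^{(r)},F_1^{(r)},\ldots,F_{n-1}^{(r)})=\left\lfloor\frac{2^n+2^r-2}{2^{r+1}-2}\right\rfloor.$$
   Context: For $r\ge2$, the generalized Fibonacci numbers are defined by $F_0^{(r)}=\cdots=F_{r-2}^{(r)}=0$, $F_{r-1}^{(r)}=1$, and $F_n^{(r)}=F_{n-1}^{(r)}+F_{n-2}^{(r)}+\cdots+F_{n-r}^{(r)}$ for $n\geq r$. For numbers $a_0,\ldots,a_n$, $\det(a_0;a_1,\ldots,a_n)$ denotes the determinant of the $n\times n$ Toeplitz--Hessenberg matrix whose $(i,j)$ entry is $a_{i-j+1}$ if $i-j+1\ge0$ and $0$ otherwise. *)

(* Defs.v *)
From mathcomp Require Import all_boot all_order all_algebra.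

Set Implicit Arguments.
Unset Strict Implicit.
Unset Printing Implicit Defensive.

(* [s] lists the values F_{n-1}, ..., F_0, most recent first, and the result is
   F_n. *)
Definition gfib_next (r : nat) (s : seq nat) : nat :=
  let n := size s in
  if n < r.-1 then 0 else if n == r.-1 then 1 else sumn (take r s).

Fixpoint gfib_hist (r n : nat) : seq nat :=
  if n is m.+1 then let s := gfib_hist r m in gfib_next r s :: s else [::].

Definition gfib (r n : nat) : nat := gfib_next r (gfib_hist r n).

Lemma gfib_histE (r n : nat) :
  gfib_hist r n = [seq gfib r (n - i) | i <- iota 1 n].
Proof.
elim: n => [//|n IHn] /=.
rewrite subSS subn0 {2}IHn -[2]/(1 + 1) iotaDl -map_comp; congr (_ :: _).
Qed.

Lemma size_gfib_hist (r n : nat) : size (gfib_hist r n) = n.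
Proof. by rewrite gfib_histE size_map size_iota. Qed.

Lemma gfib_init (r n : nat) : n < r.-1 -> gfib r n = 0.
Proof. by move=> ltnr; rewrite /gfib /gfib_next size_gfib_hist ltnr. Qed.

Lemma gfib_one (r : nat) : gfib r r.-1 = 1.
Proof. by rewrite /gfib /gfib_next size_gfib_hist ltnn eqxx. Qed.

Lemma gfib_rec (r n : nat) : 0 < r -> r <= n ->
  gfib r n = \sum_(1 <= i < r.+1) gfib r (n - i).
Proof.
case: r => // r _ ltrn; rewrite {1}/gfib /gfib_next size_gfib_hist /=.
rewrite ltnNge (ltnW ltrn) /= gtn_eqF // gfib_histE -map_take take_iota.
by rewrite (minn_idPl ltrn) sumnE big_map /index_iota subSS subn0.
Qed.

Local Open Scope ring_scope.

(* With 0-based i and j, the index i - j + 1 is nonnegative iff j <= i + 1. *)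
Definition toeplitz_hessenberg (R : comNzRingType) (n : nat) (a0 : R)
    (a : n.-tuple R) : 'M[R]_n :=
  \matrix_(i < n, j < n) (if (j <= i.+1)%N then (a0 :: a)`_(i.+1 - j) else 0).

Definition det_th (R : comNzRingType) (n : nat) (a0 : R) (a : n.-tuple R) : R :=
  \det (toeplitz_hessenberg a0 a).

(* Main.v *)
Require Import Defs.
From mathcomp Require Import all_boot all_order all_algebra.
From mathcomp Require Import zify ring lra.
Import GRing.Theory Num.Theory.
Local Open Scope ring_scope.

(** With [D_n] the determinant and [D_0 = 1], expansion along the first row
    gives [D_(n+1) = \sum_(k <= n) F_k D_(n-k)].  Since [F] satisfies
    [F_(k+1) = 2 F_k - F_(k-r)] away from the initial values, this convolution
    gives [D_(m+r+1) - D_(m+1) = 2 (D_(m+r) - D_m)] for [m >= 1], hence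
    [D_(m+r) = D_m + 2^(m-1)].  As [(2^(m+r) - 2^m) / (2^(r+1) - 2) = 2^(m-1)],
    the right-hand side increases by the same amount when [n] increases by [r],
    and the two sides agree for [1 <= n <= r]. *)

(* Replacing the first column by an arbitrary [c] makes the first-row expansion
   stable under induction: the minor of the superdiagonal entry has the same
   shape, with [c] shifted. *)
Definition hessenberg_col {R : comNzRingType} (n : nat) (b c : nat -> R) :
    'M[R]_n :=
  \matrix_(i < n, j < n) (if j == 0 :> nat then c i
    else if (j <= i.+1)%N then b (i.+1 - j)%N else 0).

Lemma det_hessenberg_col {R : comNzRingType} (n : nat) (b c : nat -> R) :
  \det (hessenberg_col n.+1 b c) =
  \sum_(k < n.+1) (- b 0) ^+ k * c k *
    \det (hessenberg_col (n - k) b (fun i => b i.+1)).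
Proof.
elim: n c => [|n IHn] c.
  by rewrite det_mx11 !mxE big_ord1 /= subn0 det_mx00 mul1r mulr1.
(* The first row vanishes beyond its second entry [b 0], whose cofactor sign gives the factor
   [- b 0]. *)
rewrite (expand_det_row _ ord0) 2!big_ord_recl [X in _ + (_ + X)]big1 ?addr0.
  rewrite big_ord_recl subn0 expr0 mul1r /cofactor !mxE /= expr0 mul1r expr1.
  congr (_ * \det _ + _).
    by apply/matrixP => i j; rewrite !mxE /= /bump /=; case: (j : nat).
  have -> : row' ord0 (col' (lift ord0 ord0) (hessenberg_col n.+2 b c)) =
            hessenberg_col n.+1 b (fun i => c i.+1).
    apply/matrixP => i j; rewrite !mxE /= /bump /=.
    by case: (j : nat) => [|m] //=; rewrite !add1n ltnS.
  rewrite IHn mulN1r mulrN -mulNr mulr_sumr; apply: eq_bigr => k _.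
  by rewrite /bump /= add1n subSS exprS !mulrA.
by move=> j _; rewrite !mxE /= mul0r.
Qed.

(** A Toeplitz first column is the special case [c i = b i.+1]. *)
Lemma det_th_hessenberg_col (R : comNzRingType) (n : nat) (a0 : R)
    (a : nat -> R) :
  det_th a0 [tuple a k | k < n] =
  \det (hessenberg_col n (fun k => if k is j.+1 then a j else a0) a).
Proof.
congr (\det _); apply/matrixP => i j; rewrite !mxE.
have [-> /=|j0] := eqVneq (j : nat) 0%N.
  by rewrite (nth_map i) ?size_enum_ord // nth_enum_ord.
case: ifP => // jle; case ij: (i.+1 - j)%N => [//|m] /=.
have mn : (m < n)%N by have := ltn_ord i; lia.
by rewrite (nth_map i) ?size_enum_ord // nth_enum_ord.
Qed.

Lemma sum_delta {n a : nat} (g : nat -> int) : (a <= n)%N ->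
  \sum_(k < n.+1) (k == a :> nat)%:Z * g (n - k)%N = g (n - a)%N.
Proof.
move=> an; have an1 : (a < n.+1)%N by [].
rewrite (bigD1 (Ordinal an1)) //= eqxx mul1r big1 ?addr0 // => i.
by rewrite -val_eqE /= => /negPf->; rewrite mul0r.
Qed.

Section FibonacciDeterminant.

Variable r : nat.
Hypothesis r_ge2 : (2 <= r)%N.

Let f (k : nat) : int := (gfib r k)%:Z.
Let D (n : nat) : int := det_th (-1) [tuple f k | k < n].

Lemma det_gfib0 : D 0 = 1.
Proof. exact: det_mx00. Qed.

Lemma det_gfibS (n : nat) : D n.+1 = \sum_(k < n.+1) f k * D (n - k).
Proof.
rewrite /D det_th_hessenberg_col det_hessenberg_col.
(* The signs disappear since [a0 = -1], and the remaining minors are again of Toeplitz form. *)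
apply: eq_bigr => k _; rewrite opprK expr1n mul1r.
rewrite det_th_hessenberg_col; congr (_ * \det _).
Qed.

Lemma gfib_r : gfib r r = 1%N.
Proof.
rewrite gfib_rec //; last lia.
rewrite big_ltn ?subn1 ?gfib_one; last lia.
rewrite big_nat big1 // => i ir; apply: gfib_init; lia.
Qed.

(** The windows of [r] terms summing to [F_(k+1)] and [F_k] differ only in [F_k] and [F_(k-r)]. *)
Lemma gfib_double {k : nat} : (r <= k)%N ->
  (gfib r k.+1 + gfib r (k - r) = (gfib r k).*2)%N.
Proof.
move=> rk; rewrite -addnn [X in (_ = _ + X)%N]gfib_rec ?(ltnW r_ge2) //.
rewrite gfib_rec ?(ltnW r_ge2) ?leqW //.
rewrite big_ltn; last lia.
rewrite subn1 /= -addnA; congr (_ + _)%N.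
rewrite [RHS]big_nat_recr /=; last lia.
congr (_ + _)%N; by rewrite big_add1 /=; apply: eq_bigr => i _; rewrite subSS.
Qed.

(** The indicators correct the doubling rule at the start: [F_(r-1) = 1] follows a zero, and [F_r]
    is 1 rather than 2. *)
Lemma gfib_stepZ (k : nat) :
  f k.+1 = 2 * f k - (if (r <= k)%N then f (k - r) else 0)
           + (k.+2 == r)%:Z - (k.+1 == r)%:Z.
Proof.
rewrite /f; case: leqP => rk; first by have := gfib_double rk; lia.
have [kr|kr1] := eqVneq k.+1 r.
  by rewrite kr gfib_r -[k]/(k.+1.-1) kr gfib_one; lia.
rewrite (gfib_init (n := k)); last lia.
have [kr|kr2] := eqVneq k.+2 r.
  by rewrite -[k.+1]/(k.+2.-1) kr gfib_one.
by rewrite gfib_init //; lia.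
Qed.

Lemma det_gfib_small (n : nat) : (0 < n < r)%N -> D n = 0.
Proof.
case: n => // n nr; rewrite det_gfibS big1 // => k _.
rewrite /f gfib_init ?mul0r //; have := ltn_ord k; lia.
Qed.

Lemma det_gfib_r : D r = 1.
Proof.
have rE : r.-1.+1 = r by lia.
rewrite -{1}rE det_gfibS -[RHS]det_gfib0 -[in RHS](subnn r.-1).
rewrite -(sum_delta D (leqnn _)); apply: eq_bigr => k _.
have [->|kr] := eqVneq (k : nat) r.-1; first by rewrite /f gfib_one.
by rewrite /f gfib_init //; have := ltn_ord k; lia.
Qed.

(** Convolving [gfib_stepZ] with [D] turns each of its terms into one value of [D]. The case [m = 0]
    is false, as [D 0 = 1] does not come from the convolution. *)
Lemma det_gfib_step {m : nat} : (0 < m)%N ->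
  D (m + r).+1 - D m.+1 = 2 * (D (m + r) - D m).
Proof.
(* [F_0 = 0] because [r >= 2], so the sum can be reindexed over [F_(k+1)]. *)
case: m => // m _; rewrite addSn det_gfibS big_ord_recl /= {1}/f gfib_init; last lia.
rewrite mul0r add0r.
under eq_bigr => k _.
  rewrite /bump /= add1n subSS gfib_stepZ mulrBl mulrDl mulrBl -mulrA.
  over.
rewrite !(sumrB, big_split) /= -mulr_sumr -det_gfibS.
have -> : \sum_(k < (m + r).+1) (if (r <= k)%N then f (k - r) else 0) *
     D (m + r - k) = D m.+1.
  rewrite det_gfibS -addSn addnC big_split_ord /= big1 ?add0r => [|k _]; last first.
    by rewrite leqNgt ltn_ord mul0r.
  apply: eq_bigr => k _; rewrite leq_addr addKn; congr (_ * D _); lia.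
have -> : \sum_(k < (m + r).+1) (k.+2 == r)%:Z * D (m + r - k) = D m.+2.
  have -> : m.+2 = (m + r - r.-2)%N by lia.
  rewrite -(sum_delta D (a := r.-2)); last lia.
  by apply: eq_bigr => k _; congr (_%:Z * _); lia.
have -> : \sum_(k < (m + r).+1) (k.+1 == r)%:Z * D (m + r - k) = D m.+1.
  have -> : m.+1 = (m + r - r.-1)%N by lia.
  rewrite -(sum_delta D (a := r.-1)); last lia.
  by apply: eq_bigr => k _; congr (_%:Z * _); lia.
ring.
Qed.

(** Only [F_(r-1) D_1] and [F_r D_0] survive; this starts the induction for [det_gfib_shift]. *)
Lemma det_gfib_r1 : D r.+1 = D 1 + 1.
Proof.
rewrite det_gfibS big_ord_recr /= subnn det_gfib0 mulr1 {2}/f gfib_r.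
congr (_ + _); have -> : 1%N = (r - r.-1)%N by lia.
rewrite -(sum_delta D (leq_pred r)) [RHS]big_ord_recr /= gtn_eqF; last lia.
rewrite mul0r addr0; apply: eq_bigr => k _.
have [->|kr] := eqVneq (k : nat) r.-1; first by rewrite /f gfib_one.
by rewrite /f gfib_init //; have := ltn_ord k; lia.
Qed.

Lemma det_gfib_shift (m : nat) : D (m.+1 + r) = D m.+1 + 2 ^+ m.
Proof.
elim: m => [|m IHm]; first by rewrite add1n det_gfib_r1.
have := det_gfib_step (ltn0Sn m); rewrite IHm -addSn exprS => H; lra.
Qed.

(** These are the inequalities defining the floor, with the denominator cleared to stay in the
    integers. *)
Lemma det_gfib_bounds (n : nat) : (0 < n)%N ->
  D n * (2 ^+ r.+1 - 2) <= 2 ^+ n + 2 ^+ r - 2 < (D n + 1) * (2 ^+ r.+1 - 2).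
Proof.
have r4 : (4 : int) <= 2 ^+ r.
  by have := ler_weXn2l (x := 2 : int) isT r_ge2; apply.
have [k] := ubnP n; elim: k n => // k IHk n nk n0.
case: (ltngtP n r) => [nr|rn|->].
- rewrite det_gfib_small; last lia.
  have n1 : (1 : int) <= 2 ^+ n by apply: exprn_ege1.
  have nr2 : (2 : int) ^+ n < 2 ^+ r by rewrite ltr_eXn2l.
  by rewrite exprS; apply/andP; split; lra.
(* From [m.+1] to [m.+1 + r] every side of the bounds grows by [2^m (2^(r+1) - 2)]. *)
- have [m mE] : exists m, n = (m.+1 + r)%N by exists (n - r).-1; lia.
  have := IHk m.+1; rewrite mE det_gfib_shift => /(_ _ _)/andP[|//|].
    lia.
  move=> lo hi; rewrite exprD !exprS in lo hi *.
  set p := 2 ^+ m in lo hi *; set q := 2 ^+ r in lo hi *; set d := D _ in lo hi *.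
  by apply/andP; split; lra.
(* At [n = r] the numerator equals the denominator. *)
- by rewrite det_gfib_r exprS; apply/andP; split; lra.
Qed.

End FibonacciDeterminant.

Theorem theorem12 (r : nat) (hr : (2 <= r)%N) (n : nat) (hn : (1 <= n)%N) :
  det_th (-1 : int) [tuple (gfib r k)%:Z | k < n] =
  Num.floor ((2 ^+ n + 2 ^+ r - 2) / (2 ^+ r.+1 - 2) : rat).
Proof.
have /andP[lo hi] := det_gfib_bounds r hr n hn.
set d := det_th _ _ in lo hi *.
have pos : (0 : rat) < 2 ^+ r.+1 - 2.
  by rewrite subr_gt0 -[ltLHS]expr1 ltr_eXn2l //; lia.
apply/esym/floor_def; rewrite ler_pdivlMr // ltr_pdivrMr //.
rewrite -(ler_int rat) in lo; rewrite -(ltr_int rat) in hi.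
rewrite !(rmorphM, rmorphB, rmorphD, rmorphXn) /= in lo hi.
by rewrite intrD lo hi.
Qed.
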